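(* Let $n\ge 1$ and let $\mathcal{I}^2_n$ be the ideal of $\mathbb{Q}[x_1,y_1,\dots,x_n,y_n]$ generated by all $B$-quasisymmetric polynomials in $x_1,y_1,\dots,x_n,y_n$ with zero constant term. Then $$\dim_{\mathbb{Q}} \mathbb{Q}[x_1,y_1,\dots,x_n,y_n]/\mathcal{I}^2_n=\frac{1}{2n+1}\binom{3n}{n}.$$
   Context: A bivector of size $k$ is a vector $c=(c_1,c_2,\dots,c_{2k})$ of nonnegative integers (odd entries refer to the variables $x$, even entries to the variables $y$). A bicomposition is a bivector with no two consecutive entries both equal to $0$ (i.e. no $c_j=c_{j+1}=0$); the empty bicomposition ($k=0$) is allowed. Write $|c|=c_1+\dots+c_{2k}$. For a bicomposition $c$ of size $k$, the fundamental $B$-quasisymmetric polynomial $F_c(x_1,y_1,\dots,x_n,y_n)$ is defined as follows: split the positions $1,\dots,|c|$ into $2k$ consecutive runs of lengths $c_1,c_2,\dots,c_{2k}$, and group runs $2t-1,2t$ into block $t$ ($t=1,\dots,k$; each block is nonempty). Then $F_c=\sum \prod_{r=1}^{|c|} z_r$, the sum over all sequences $1\le m_1\le m_2\le\dots\le m_{|c|}\le n$ such that $m_r<m_{r+1}$ whenever $r$ is the last position of a block, where $z_r=x_{m_r}$ if position $r$ lies in an odd-indexed run and $z_r=y_{m_r}$ if it lies in an even-indexed run. (E.g. $F_{(1,0,1,2)}=\sum_{i<j\le k\le l}x_ix_jy_ky_l$.) One sets $F_c=0$ if $k>n$, and $F_{\emptyset}=1$. The space $QSym_n(B)$ of $B$-quasisymmetric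 polynomials is the $\mathbb{Q}$-linear span of all $F_c(x_1,y_1,\dots,x_n,y_n)$. *)

(* Defs.v *)
From mathcomp Require Import all_boot all_order all_algebra.
From mathcomp Require Import mpoly.

Set Implicit Arguments.
Unset Strict Implicit.
Unset Printing Implicit Defensive.

Import GRing.Theory.

Local Open Scope ring_scope.

(* The polynomial ring Q[x_1, y_1, ..., x_n, y_n]: the first n indeterminates  *)
(* are the x_i, the last n are the y_i (both indexed from 0).                  *)
Notation bipoly n := {mpoly rat[n + n]}.

Definition xvar n (i : 'I_n) : bipoly n := 'X_(lshift n i).
Definition yvar n (i : 'I_n) : bipoly n := 'X_(rshift n i).

(* A bivector (c_1, ..., c_2k) is a sequence of even length; c_j is nth 0 c j.-1. *)
Definition bivector (c : seq nat) : bool := ~~ odd (size c).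

Definition bicomposition (c : seq nat) : bool :=
  bivector c && sorted (fun a b => ~~ ((a == 0%N) && (b == 0%N))) c.

(* With everything indexed from 0, position r lies in run [reshape_index c r], *)
(* runs 2t and 2t+1 form block t, and the even-numbered runs carry x.          *)
Definition run_of (c : seq nat) (r : nat) : nat := reshape_index c r.
Definition block_of (c : seq nat) (r : nat) : nat := (run_of c r)./2.

(* Position r is the last one of its block, and is not the last position       *)
(* overall, exactly when r and r.+1 lie in different blocks.                   *)
Definition admissible n (c : seq nat) (m : {ffun 'I_(sumn c) -> 'I_n}) : bool :=
  [forall r : 'I_(sumn c), forall s : 'I_(sumn c), (s == r.+1 :> nat) ==>
     (if block_of c r != block_of c s then m r < m s else m r <= m s)%N].

(* When c is a bicomposition every block is nonempty, so this sum is empty as  *)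
(* soon as c has more than n blocks; for c = [::] it is 1.                     *)
Definition fundB n (c : seq nat) : bipoly n :=
  \sum_(m : {ffun 'I_(sumn c) -> 'I_n} | admissible m)
    \prod_(r < sumn c)
      (if odd (run_of c r) then yvar (m r) else xvar (m r)).

Definition QSymB n (p : bipoly n) : Prop :=
  exists (N : nat) (a : 'I_N -> rat) (c : 'I_N -> seq nat),
    (forall i, bicomposition (c i)) /\ p = \sum_(i < N) a i *: fundB n (c i).

Definition ideal_gen (R : comNzRingType) (S : R -> Prop) (p : R) : Prop :=
  exists (N : nat) (f g : 'I_N -> R),
    (forall i, S (g i)) /\ p = \sum_(i < N) f i * g i.

Definition idealB n : bipoly n -> Prop :=
  ideal_gen (fun p : bipoly n => QSymB p /\ p@_(0%MM) = 0).

(* dim V / W = d: the classes modulo the subspace W of some d vectors of V     *)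
(* span V / W and are linearly independent in V / W.                           *)
Definition quot_dim (K : fieldType) (V : lmodType K) (W : V -> Prop) (d : nat)
    : Prop :=
  exists b : 'I_d -> V,
    (forall v : V, exists a : 'I_d -> K, W (v - \sum_(i < d) a i *: b i)) /\
    (forall a : 'I_d -> K, W (\sum_(i < d) a i *: b i) -> forall i, a i = 0).

(* Main.v *)
Require Import Defs.
From HB Require Import structures.
From mathcomp Require Import all_boot all_order all_algebra.
From mathcomp Require Import mpoly.
From mathcomp Require Import zify.

(* List the variables as z = x_1, y_1, x_2, y_2, ..., call u in N^(2n)         *)
(* transdiagonal when 2 (u_1 + ... + u_j) >= j for some j > 0, and good        *)
(* otherwise. The monomials z^u with u good form a basis of the quotient.      *)
(*                                                                             *)
(* Independence (after Nadeau, Spink and Tewari): let R_q substitute           *)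
(* z_1, ..., z_(q-1), 0, 0, z_q, ... for z. A quasisymmetric polynomial has    *)
(* the same image under all R_q, so T_q := (R_(q+1) - R_q) / z_q sends the     *)
(* ideal in n pairs of variables to the ideal in n - 1 pairs, by the twisted   *)
(* Leibniz rule. It also preserves the absence of transdiagonal monomials.     *)
(* Hence, by induction on n, a combination f of good monomials that lies in    *)
(* the ideal is killed by every T_q, i.e. its coefficients are unchanged when  *)
(* an entry preceded by two zeros moves past them. Moving the first nonzero    *)
(* entry of u to the left ends on a transdiagonal vector, so f = 0.            *)
(*                                                                             *)
(* Spanning (after Aval, F. Bergeron and N. Bergeron): for w b transdiagonal,  *)
(* the ideal contains z^w F_b(z_k, z_(k+1), ...), k = |w| + 1, up to monomials *)
(* whose exponent has a prefix lexicographically below w. For w empty this is  *)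
(* F_b itself. The top coefficient of F_(a b) in its first variable is F_b in  *)
(* the other ones, which moves a from b to w; when this would create a pair of *)
(* zeros in b, one uses                                                        *)
(*   F_(c b)(z_(k+2), ...) = F_(c b)(z_k, ...) - z_k F_((c-1) b)(z_k, ...).    *)
(* With b empty, every transdiagonal monomial reduces to smaller ones.         *)
(*                                                                             *)
(* Good vectors of length j and sum h are counted by the ballot numbers        *)
(* (j - 2h) / (j + h) * binomial (j + h, h); appending to a good vector of     *)
(* length 2n the entry that makes its sum n gives j = 2n + 1, h = n.           *)

(** Both halves rest on one remark: replacing [0, 0, c.+1] by [c] inside a vector takes two entries
    and one unit of sum from every later prefix, so it respects [2 * sum >= length] ([trans_00],
    [trans_insert00]). Spanning comes from the recursion [F_consS] through [low_F_trans] and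
    [mon_mem]; independence from the invariance [F_insert00] through [ins_diff_dvd] and
    [qsym_ideal_free]. [fundB_F] identifies the given polynomials with [F], and [size_good_enum]
    counts. *)

Set Implicit Arguments.
Unset Strict Implicit.
Unset Printing Implicit Defensive.

Import GRing.Theory.

Local Open Scope ring_scope.

(** * Fundamental polynomials *)

Definition no00 (a b : nat) : bool := ~~ ((a == 0%N) && (b == 0%N)).

Section Fundamental.

Variable A : comNzRingType.
Implicit Types (zs : seq A) (b u : seq nat).

Fixpoint blocksum (h : seq A -> A) (zs : seq A) {struct zs} : A :=
  match zs with
  | [::] => 0
  | z :: zs1 =>
      z * h zs + match zs1 with [::] => 0 | _ :: zs2 => blocksum h zs2 end
  end.

(* [F c [:: x_1; y_1; ...; x_n; y_n]] is the fundamental polynomial F_c (see   *)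
(* [fundB_F]); the first entry of [b] belongs to the first of the variables    *)
(* [zs], and [blocksum] drops variables in pairs x_i, y_i.                     *)
Fixpoint F (b : seq nat) : seq A -> A :=
  match b with
  | [::] => fun=> 1
  | a :: b' => iter a blocksum (fun zs => F b' (behead zs))
  end.

Lemma F_nil_vars a b : F (a.+1 :: b) [::] = 0. Proof. by []. Qed.

Lemma F_cons0 b zs : F (0%N :: b) zs = F b (behead zs). Proof. by []. Qed.

Lemma F_consS a b z zs :
  F (a.+1 :: b) (z :: zs) = z * F (a :: b) (z :: zs) + F (a.+1 :: b) (behead zs).
Proof. by case: zs. Qed.

Lemma F_drop a b zs k : (k < size zs)%N ->
  F (a.+1 :: b) (drop k zs) =
  nth 0 zs k * F (a :: b) (drop k zs) + F (a.+1 :: b) (drop k.+2 zs).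
Proof.
by move=> ltk; rewrite (drop_nth 0 ltk) F_consS -drop1 drop_drop.
Qed.

Lemma F_sumn0 b zs : sumn b = 0%N -> F b zs = 1.
Proof. by elim: b zs => [|[|a] b IH] zs //= sb0; apply: IH. Qed.

Lemma F_rcons0 b zs : F (rcons b 0%N) zs = F b zs.
Proof.
elim: b zs => [|a b IHb] //= zs.
elim: a zs => [|a IHa] zs /=; first exact: IHb.
have [m] := ubnP (size zs); elim: m zs => // m IHm [|z [|z1 zs]] //= ltm;
  rewrite IHa //; congr (_ + _); apply: IHm; lia.
Qed.

Lemma F_nil zs : F [::] zs = 1. Proof. by []. Qed.

Arguments F : simpl never.

(** The recursion behind [F] is nested: on [b], then on its first entry, then on the number of
    variables. *)
Lemma F_ind (P : seq nat -> seq A -> Prop) :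
  (forall zs, P [::] zs) ->
  (forall b zs, P b (behead zs) -> P (0%N :: b) zs) ->
  (forall a b, P (a.+1 :: b) [::]) ->
  (forall a b z zs, P (a :: b) (z :: zs) -> P (a.+1 :: b) (behead zs) ->
     P (a.+1 :: b) (z :: zs)) ->
  forall b zs, P b zs.
Proof.
move=> Pnil P0 Pnv PS; elim=> [|a b IHb] // zs.
elim: a zs => [|a IHa] zs; first exact: P0.
have [m] := ubnP (size zs); elim: m zs => // m IHm [|z zs] //= ltm.
by apply: PS; [exact: IHa | apply: IHm; rewrite size_behead; lia].
Qed.

Lemma F_zeros b k : (0 < sumn b)%N -> F b (nseq k 0) = 0.
Proof.
move: {2}(nseq k 0) (erefl (nseq k (0 : A))) => zs ezs.
rewrite ezs => sb; have {ezs}: all (pred1 0) zs by rewrite -ezs all_pred1_nseq.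
move: b zs sb; apply: F_ind => //.
- by move=> b [|z zs] //= IH sb /andP[_]; apply: IH.
- move=> a b z zs _ IH sb /= /andP[/eqP-> zs0]; rewrite F_consS mul0r add0r.
  by apply: IH => //; case: zs zs0 => //= ? ? /andP[].
Qed.

Definition insert00 (T : Type) (x : T) q (s : seq T) : seq T :=
  take q s ++ x :: x :: drop q s.

(* Inserting two consecutive zero variables is the defining invariance of     *)
(* quasisymmetry for pairs of variables. The disjunction makes the induction   *)
(* on [b] go through: lowering the first entry of [b] may create a [0, 0].     *)
Lemma F_insert00_aux b zs q :
    sorted no00 (behead b) -> (0 < q)%N || sorted no00 b -> (q <= size zs)%N ->
  F b (insert00 0 q zs) = F b zs.
Proof.
move: b zs q; apply: F_ind => //.
- move=> b zs IH [|q] /= sb sb0 leq.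
    rewrite /insert00 take0 drop0 !F_cons0 /=.
    case: b sb sb0 {IH} => [|[|c] b] //= sb sb0.
    by rewrite F_consS mul0r add0r.
  case: zs leq IH => [|z zs] //= leq IH.
  rewrite !F_cons0 IH ?sb ?orbT //.
  by case: (b) sb => //= ? ? /path_sorted.
- move=> a b q _ _; rewrite leqn0 => /eqP->.
  by rewrite /insert00 take0 drop0 /= !F_consS !mul0r !add0r.
- move=> a b z zs IH1 IH2 q /= sb _ leq.
  have [->|q0] := posnP q.
    by rewrite /insert00 take0 drop0 /= F_consS mul0r add0r.
  have sab : sorted no00 (a.+1 :: b) by case: (b) sb => //= ? ? ->.
  have := IH1 q sb; rewrite q0 => /(_ isT leq) E1.
  case: q q0 leq E1 => // q _ leq; rewrite /insert00 /= => E1.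
  rewrite !F_consS E1; congr (_ + _).
  case: q leq {E1} => [|q] leq; rewrite ?take0 ?drop0 /=.
    by rewrite F_consS mul0r add0r.
  by case: zs leq IH2 {IH1} => //= z1 zs leq IH2; apply: IH2;
    rewrite ?sb -?[path _ _ _]/(sorted no00 (a.+1 :: b)) ?sab ?orbT.
Qed.

Lemma F_insert00 b zs q : sorted no00 b -> (q <= size zs)%N ->
  F b (insert00 0 q zs) = F b zs.
Proof.
move=> sb; apply: F_insert00_aux; rewrite ?sb ?orbT //.
by case: (b) sb => //= ? ? /path_sorted.
Qed.

End Fundamental.

Arguments F : simpl never.

(** * Transdiagonal vectors *)

(** A [j] beyond the end of [s] adds nothing new: the length of [s] is then a witness as well. *)
Definition trans (s : seq nat) : Prop :=
  exists j, (0 < j <= 2 * sumn (take j s))%N.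

(** The vector is read from its last entry, so that tails of [r] are prefixes of the vector. *)
Fixpoint good_rev (r : seq nat) : bool :=
  if r is a :: r' then good_rev r' && (2 * (a + sumn r') < (size r').+1)%N
  else true.

Definition good (s : seq nat) : bool := good_rev (rev s).

Lemma good_rcons s a :
  good (rcons s a) = good s && (2 * (a + sumn s) < (size s).+1)%N.
Proof. by rewrite /good rev_rcons /= sumn_rev size_rev. Qed.

Lemma trans_catl s t : trans s -> trans (s ++ t).
Proof.
case=> j /andP[j0 lej]; exists j; rewrite j0 take_cat.
case: ltnP => // le_sj; rewrite sumn_cat.
by move: lej; rewrite take_oversize //; lia.
Qed.

Lemma goodPn s : reflect (trans s) (~~ good s).
Proof.
apply: (iffP idP).
  elim/last_ind: s => [|s a IHs] //; rewrite good_rcons negb_and.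
  case/orP=> [/IHs ts|]; first by rewrite -cats1; apply: trans_catl.
  rewrite -leqNgt => le_s; exists (size s).+1.
  by rewrite -(size_rcons s a) take_size size_rcons sumn_rcons; lia.
case=> j /andP[j0 lej]; elim/last_ind: s lej => [|s a IHs].
  by rewrite /=; lia.
rewrite good_rcons negb_and -cats1 take_cat.
case: ltnP => [_ /IHs-> //|le_sj]; rewrite sumn_cat => lej.
have [e|e] := eqVneq j (size s).
  by rewrite IHs // e take_size; move: lej; rewrite e subnn /=; lia.
apply/orP; right; rewrite -leqNgt.
have : (sumn (take (j - size s) [:: a]) <= a)%N.
  by case: (j - size s)%N => [|[|k]] //=; lia.
lia.
Qed.

(** A witness prefix that ends inside the two zeros is cut back to [w]; a longer one loses length
    two and sum one. *)
Lemma trans_00 w c g : trans (w ++ [:: 0%N, 0%N, c.+1 & g]) -> trans (w ++ c :: g).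
Proof.
have w0 : size w = 0%N -> sumn w = 0%N by case: w.
case=> j /andP[j0]; rewrite take_cat; case: ltnP => [ltj lej|lewj].
  by exists j; rewrite j0 take_cat ltj.
case: (j - size w)%N (subnKC lewj) => [|[|[|k]]] /= ej; rewrite sumn_cat /= => lej.
- exists j; rewrite j0 take_cat ltnNge lewj /= sumn_cat; lia.
- exists (size w); rewrite take_cat ltnn subnn take0 cats0; lia.
- exists (size w); rewrite take_cat ltnn subnn take0 cats0; lia.
exists (size w + k.+1)%N; rewrite take_cat.
have -> : (size w + k.+1 < size w)%N = false by lia.
by rewrite addKn sumn_cat /=; lia.
Qed.

Lemma trans_S w c g : trans (w ++ c :: g) -> trans (w ++ c.+1 :: g).
Proof.
case=> j /andP[j0 lej]; exists j; rewrite j0; apply: leq_trans lej _.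
rewrite leq_mul2l /= !take_cat; case: ltnP => // _.
by rewrite !sumn_cat leq_add2l; case: (j - size w)%N => //= k; lia.
Qed.

Lemma trans_rcons0 w : trans (rcons w 0%N) -> trans w.
Proof.
case=> j /andP[j0]; rewrite -cats1 take_cat; case: ltnP => [ltj lej|lewj].
  by exists j; rewrite j0.
rewrite sumn_cat => lej; exists j; rewrite j0 take_oversize //.
by apply: leq_trans lej _; case: (j - size w)%N => [|[|k]] /=; lia.
Qed.

Lemma trans_nil : ~ trans [::].
Proof. by case=> j /=; lia. Qed.

(** * Spanning *)

(** The default of [head] also forbids a final zero, so a nonempty such vector has positive sum. *)
Fixpoint ok (b : seq nat) : bool :=
  if b is a :: b' then ok b' && ((0 < a) || (0 < head 0 b'))%N else true.

Lemma ok_sorted b : ok b -> sorted no00 b.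
Proof.
elim: b => [|a [|c b] IHb] // /andP[/IHb sb /= ac].
by move: sb => /= ->; rewrite andbT /no00; lia.
Qed.

(* Only the first [size w] entries of [v] matter. *)
Fixpoint lexlt (v w : seq nat) : bool :=
  match v, w with
  | a :: v', c :: w' => (a < c)%N || (a == c) && lexlt v' w'
  | _, _ => false
  end.

Lemma lexlt_catl v t w : lexlt v w -> lexlt (v ++ t) w.
Proof.
by elim: v w => [|a v IHv] [|c w] //= /orP[->|/andP[-> /IHv->]] //; rewrite orbT.
Qed.

Lemma lexlt_rcons v w a : lexlt v w -> lexlt v (rcons w a).
Proof.
by elim: v w => [|c v IHv] [|d w] //= /orP[->|/andP[-> /IHv->]] //; rewrite orbT.
Qed.

Lemma lexlt_rcons0 v w : lexlt v (rcons w 0%N) -> lexlt v w.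
Proof.
elim: v w => [|c v IHv] [|d w] //=; first by case: v {IHv} => [|? ?]; rewrite /= andbF.
by case/orP=> [->|/andP[-> /IHv->]] //; rewrite orbT.
Qed.

Lemma lexlt_rcons2 w a c : (a < c)%N -> lexlt (rcons w a) (rcons w c).
Proof. by move=> ltac; elim: w => [|d w IHw] /=; rewrite ?ltac ?eqxx ?IHw ?orbT. Qed.

Lemma lexlt_incr v w k : (size w <= k)%N -> lexlt v w -> lexlt (incr_nth v k) w.
Proof.
elim: v w k => [|a v IHv] [|c w] [|k] //= le_wk /orP[->|/andP[-> /IHv->]] //.
by rewrite orbT.
Qed.

Lemma lexlt_incr_rcons v w c :
  lexlt v (rcons w c) -> lexlt (incr_nth v (size w)) (rcons w c.+1).
Proof.
elim: v w => [|a v IHv] [|d w] //=.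
by case/orP=> [->|/andP[-> /IHv->]] //; rewrite orbT.
Qed.

(** At a fixed length the lexicographic order is well founded: induction on the length, then on the
    first entry. *)
Lemma lexlt_ind N (P : seq nat -> Prop) :
  (forall w, size w = N ->
     (forall v, size v = N -> lexlt v w -> P v) -> P w) ->
  forall w, size w = N -> P w.
Proof.
elim: N P => [|N IHN] P Pw.
  by case=> // _; apply: Pw => // v /size0nil->.
case=> // a w [sw]; have [m] := ubnP a.
elim: m a w sw => // m IHm a w sw; rewrite ltnS => leam.
apply: (IHN (fun w => P (a :: w))) sw => {}w sw Pv.
apply: Pw => /= [|[|c v] //= [sv] /orP[ltca|/andP[/eqP->]]]; first by rewrite sw.
  by apply: IHm => //; apply: leq_trans ltca leam.
by apply: Pv.
Qed.

Section Monomials.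

Variable A : comNzRingType.
Implicit Types (zs : seq A) (u : seq nat).

Fixpoint mon zs u : A :=
  match zs, u with
  | z :: zs', a :: u' => z ^+ a * mon zs' u'
  | _, _ => 1
  end.

Lemma mon_cat zs1 zs2 u1 u2 : size zs1 = size u1 ->
  mon (zs1 ++ zs2) (u1 ++ u2) = mon zs1 u1 * mon zs2 u2.
Proof.
elim: zs1 u1 => [|z zs1 IH] [|a u1] //=; first by rewrite mul1r.
by case=> /IH->; rewrite mulrA.
Qed.

Lemma mon_nseq0 zs k : mon zs (nseq k 0%N) = 1.
Proof. by elim: zs k => [|z zs IH] [|k] //=; rewrite IH mulr1. Qed.

Lemma mon_incr zs u k : (k < size zs)%N -> (k < size u)%N ->
  mon zs (incr_nth u k) = nth 0 zs k * mon zs u.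
Proof.
elim: zs u k => [|z zs IH] [|a u] [|k] //= ltk ltu; first by rewrite exprS mulrA.
by rewrite IH // mulrCA.
Qed.

Lemma mon_rcons0 zs z u : size zs = size u -> mon (rcons zs z) (rcons u 0%N) = mon zs u.
Proof. by move=> szu; rewrite -!cats1 mon_cat //= expr0 !mulr1. Qed.

End Monomials.

Section Spanning.

Variables (A : comNzRingType) (I : A -> Prop) (zs : seq A).
Hypothesis I_M : forall r p, I p -> I (r * p).
Hypothesis I_F : forall b, ok b -> b != [::] -> I (F b zs).

Let N := size zs.

Lemma ideal0 : I 0.
Proof. by rewrite -(mul0r (F [:: 1%N] zs)); apply/I_M/I_F. Qed.

(** The additive group generated by [I] and the monomials below [w]; congruences modulo [I] become
    membership in it. *)
Inductive low (w : seq nat) : A -> Prop :=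
| low_I p : I p -> low w p
| low_mon v : size v = N -> lexlt v w -> low w (mon zs v)
| low_D p q : low w p -> low w q -> low w (p + q)
| low_N p : low w p -> low w (- p).

Lemma low_B w p q : low w p -> low w q -> low w (p - q).
Proof. by move=> lp lq; apply/low_D/low_N. Qed.

Lemma low_sub w1 w2 p : (forall v, lexlt v w1 -> lexlt v w2) ->
  low w1 p -> low w2 p.
Proof.
move=> sub; elim=> [r Ir|v sv /sub|r s _ lr _ ls|r _ lr].
- exact: low_I.
- exact: low_mon.
- exact: low_D.
- exact: low_N.
Qed.

Lemma low_mulz w1 w2 k p : (k < N)%N ->
    (forall v, lexlt v w1 -> lexlt (incr_nth v k) w2) ->
  low w1 p -> low w2 (nth 0 zs k * p).
Proof.
move=> ltk sub; elim=> [r Ir|v sv /sub ltv|r s _ lr _ ls|r _ lr].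
- exact/low_I/I_M.
- by rewrite -mon_incr ?sv //; apply: low_mon; rewrite ?size_incr_nth ?sv ?ltk.
- by rewrite mulrDr; apply: low_D.
- by rewrite mulrN; apply: low_N.
Qed.

(** Every monomial of the product starts with the exponents [v], which already decide the comparison
    with [w]. *)
Lemma low_F w zs1 zs2 v b : zs = zs1 ++ zs2 -> size zs1 = size v ->
  (size w <= size v)%N -> lexlt v w -> low w (mon zs1 v * F b zs2).
Proof.
move: b zs2 zs1 v; apply: F_ind.
- move=> zs2 zs1 v ezs szv swv ltvw; rewrite F_nil mulr1.
  rewrite -[mon zs1 v]mulr1 -(mon_nseq0 zs2 (size zs2)) -mon_cat // -ezs.
  by apply: low_mon; rewrite ?lexlt_catl // size_cat size_nseq -szv -size_cat -ezs.
- move=> b [|z zs2] IH zs1 v ezs szv swv ltvw; rewrite F_cons0; first exact: IH.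
  rewrite -(mon_rcons0 z) //; apply: IH; rewrite ?cat_rcons ?size_rcons ?szv //.
    exact: leqW.
  by rewrite -cats1 lexlt_catl.
- by move=> a b zs1 v *; rewrite mulr0; apply/low_I/ideal0.
- move=> a b z zs2 IH1 IH2 zs1 v ezs szv swv ltvw; rewrite F_consS mulrDr.
  apply: low_D.
    have ez : nth 0 zs (size v) = z by rewrite ezs nth_cat szv ltnn subnn.
    rewrite mulrCA -{1}ez; apply: low_mulz (IH1 _ _ ezs szv swv ltvw).
      by rewrite /N ezs size_cat /= szv; lia.
    by move=> u; apply: lexlt_incr.
  rewrite -(mon_rcons0 z) //.
  case: zs2 ezs IH2 {IH1} => [|z1 zs2] ezs /= IH2.
    by apply: IH2; rewrite ?cats0 -?cats1 ?size_cat ?lexlt_catl ?szv //= addn1 leqW.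
  rewrite -(mon_rcons0 z1) ?size_rcons ?szv //; apply: IH2.
  - by rewrite -!cats1 ezs -!catA.
  - by rewrite !size_rcons szv.
  - by rewrite !size_rcons !leqW.
  - by rewrite -!cats1 !lexlt_catl.
Qed.

(** As a polynomial in [z], [F (a :: b)] has degree at most [a], with [F b zs2] as coefficient of
    [z ^+ a]. *)
Lemma low_F_cons w a b z zs1 zs2 : zs = zs1 ++ z :: zs2 -> size zs1 = size w ->
  low (rcons w a)
    (mon zs1 w * F (a :: b) (z :: zs2) - mon (rcons zs1 z) (rcons w a) * F b zs2).
Proof.
move=> ezs szw; have ez : nth 0 zs (size w) = z by rewrite ezs nth_cat szw ltnn subnn.
elim: a => [|a IHa].
  by rewrite F_cons0 mon_rcons0 // subrr; apply/low_I/ideal0.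
have lowz : low (rcons w a.+1) (z *
   (mon zs1 w * F (a :: b) (z :: zs2) - mon (rcons zs1 z) (rcons w a) * F b zs2)).
  rewrite -{1}ez; apply: low_mulz IHa; last by move=> v; apply: lexlt_incr_rcons.
  by rewrite /N ezs size_cat szw /=; lia.
have lowF : low (rcons w a.+1) (mon zs1 w * F (a.+1 :: b) (behead zs2)).
  rewrite -(mon_rcons0 z) // -F_cons0; apply: low_F; rewrite ?size_rcons ?szw //.
    by rewrite cat_rcons.
  exact: lexlt_rcons2.
rewrite F_consS mulrDr addrAC; apply: low_D lowF.
suff -> : mon (rcons zs1 z) (rcons w a.+1) = z * mon (rcons zs1 z) (rcons w a).
  by rewrite -mulrA mulrCA -mulrBr.
by rewrite -!cats1 !mon_cat //= !mulr1 exprS mulrCA.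
Qed.

(** The outer induction is on the total degree, the inner one on [w] from its end: handing the last
    entry of [w] to [b] keeps the degree, while the correction term lowers it and may leave [w] as
    long as before. *)
Lemma low_F_trans w b zs1 zs2 : zs = zs1 ++ zs2 -> size zs1 = size w ->
  ok b -> trans (w ++ b) -> low w (mon zs1 w * F b zs2).
Proof.
have [d] := ubnP (sumn w + sumn b); elim: d w b zs1 zs2 => // d IHd w b zs1 zs2.
elim/last_ind: w b zs1 zs2 => [|w a IHw] b zs1 zs2 ltd ezs szw okb tb.
  apply: low_I; case: zs1 szw ezs => //= _ <-; rewrite mul1r.
  by apply: I_F => //; apply/eqP => b0; move: tb; rewrite b0; apply: trans_nil.
elim/last_ind: zs1 szw ezs => [|zs1 z _]; rewrite !size_rcons // => -[szw].
rewrite cat_rcons => ezs; move: tb; rewrite cat_rcons => tb.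
have [okab|] := boolP (ok (a :: b)).
  have lowC := @low_F_cons w a b _ _ _ ezs szw.
  rewrite -[X in low _ X](subKr (mon zs1 w * F (a :: b) (z :: zs2))).
  apply: low_B lowC; apply: low_sub (fun v => @lexlt_rcons v w a) _.
  by apply: IHw => //=; move: ltd; rewrite sumn_rcons; lia.
(* Here [a = 0], and [b], being [ok], is empty or starts with [0, c.+1]. *)
rewrite /= okb /= negb_or -!eqn0Ngt => /andP[/eqP a0 hb]; subst a.
have low0 : forall p, low w p -> low (rcons w 0%N) p.
  by move=> p; apply: low_sub => v; apply: lexlt_rcons.
have low0' : forall p, low (rcons w 0%N) p -> low w p.
  by move=> p; apply: low_sub => v; apply: lexlt_rcons0.
rewrite sumn_rcons addn0 in ltd.
case: b okb hb tb ltd => [|[|?] [|[|c] b]] //= okb _ tb ltd.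
- rewrite mon_rcons0 //; apply: low0; rewrite F_nil -(F_nil (z :: zs2)).
  apply: IHw => //=.
  by rewrite cats0; apply: trans_rcons0; rewrite -cats1.
- by move: okb; rewrite andbF.
rewrite F_cons0 mon_rcons0 //.
have -> : F (c.+1 :: b) (behead zs2) =
    F (c.+1 :: b) (z :: zs2) - z * F (c :: b) (z :: zs2).
  by rewrite F_consS addrAC subrr add0r.
have tc := trans_00 tb.
have okb1 : ok b by case/andP: okb => /andP[].
rewrite mulrBr mulrCA; apply: low0; apply: low_B.
  by apply: IHw; rewrite //= ?okb1 //; apply: trans_S.
have {1}<- : nth 0 zs (size w) = z by rewrite ezs nth_cat szw ltnn subnn.
apply: (@low_mulz w); first by rewrite /N ezs size_cat szw /=; lia.
  by move=> v; apply: lexlt_incr.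
have [okc|] := boolP (ok (c :: b)).
  by apply: IHd => //=; lia.
(* Now [c = 0] cannot stay in front of [b]; it is appended to [w] instead, which [IHd] permits as
   the degree has dropped. *)
rewrite /= okb1 /= negb_or -!eqn0Ngt => /andP[/eqP c0 _].
subst c; rewrite F_cons0 -(mon_rcons0 z) //; apply: low0'; apply: IHd => //.
- by rewrite sumn_rcons; move: ltd => /=; lia.
- by rewrite cat_rcons.
- by rewrite !size_rcons szw.
- by rewrite cat_rcons.
Qed.

Lemma mon_mem (V : A -> Prop) :
    (forall p q, V p -> V q -> V (p + q)) -> (forall p, V p -> V (- p)) ->
    (forall p, I p -> V p) ->
    (forall u, size u = N -> good u -> V (mon zs u)) ->
  forall u, size u = N -> V (mon zs u).
Proof.
move=> VD VN VI Vgood; apply: lexlt_ind => w sw IHw.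
have [|/goodPn tw] := boolP (good w); first exact: Vgood.
have : low w (mon zs w * F [::] [::]) by apply: low_F_trans; rewrite ?cats0.
rewrite F_nil mulr1; elim=> [r|v sv|r s _ Vr _ Vs|r _ Vr].
- exact: VI.
- exact: IHw.
- exact: VD.
- exact: VN.
Qed.

End Spanning.

(** * Sums over admissible sequences *)

Section ChainSums.

Variables (A : comNzRingType) (n : nat).
Implicit Types (d lb : nat) (val : nat -> 'I_n -> A) (st : nat -> bool).

(** The boolean [st r], read as 0 or 1, tells whether the step after [r] is strict. *)
Definition chain d st lb (m : {ffun 'I_d -> 'I_n}) : bool :=
  [forall r : 'I_d, (r == 0 :> nat)%N ==> (lb <= m r)%N] &&
  [forall r : 'I_d, forall s : 'I_d, (s == r.+1 :> nat) ==> (m r + st r <= m s)%N].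

Definition chainsum d val st lb : A :=
  \sum_(m | @chain d st lb m) \prod_(r < d) val r (m r).

Lemma eq_chainsum d val val' st st' lb :
    (forall r, (r < d)%N -> val r =1 val' r) ->
    (forall r, (r.+1 < d)%N -> st r = st' r) ->
  chainsum d val st lb = chainsum d val' st' lb.
Proof.
move=> eval est; apply: eq_big => [m|m _]; last by apply: eq_bigr => r _; rewrite eval.
congr (_ && _); apply: eq_forallb => r; apply: eq_forallb => s.
by case: eqP => //= es; rewrite est // -es.
Qed.

Lemma chainsum0 val st lb : chainsum 0 val st lb = 1.
Proof.
have m0 : {ffun 'I_0 -> 'I_n} by apply: finfun => -[].
rewrite /chainsum (bigD1 m0) /=; last first.
  by apply/andP; split; apply/forallP => -[].
rewrite big_ord0 big1 ?addr0 // => m /andP[_ /eqP[]].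
by apply/ffunP => -[].
Qed.

Definition ffun_cons d (im : 'I_n * {ffun 'I_d -> 'I_n}) : {ffun 'I_d.+1 -> 'I_n} :=
  [ffun r => if unlift ord0 r is Some r' then im.2 r' else im.1].

Lemma ffun_consE0 d im : @ffun_cons d im ord0 = im.1.
Proof. by rewrite ffunE unlift_none. Qed.

Lemma ffun_consES d im r : @ffun_cons d im (lift ord0 r) = im.2 r.
Proof. by rewrite ffunE liftK. Qed.

Lemma ffun_cons_bij d : bijective (@ffun_cons d).
Proof.
exists (fun m : {ffun 'I_d.+1 -> 'I_n} =>
  (m ord0, [ffun r : 'I_d => m (lift ord0 r)])) => [[i m]|m].
  by rewrite ffun_consE0; congr (_, _); apply/ffunP => r; rewrite ffunE ffun_consES.
by apply/ffunP => r; rewrite ffunE; case: unliftP => [r' ->|->] //=; rewrite ffunE.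
Qed.

Lemma chain_cons d st lb i m :
  chain st lb (@ffun_cons d (i, m)) =
  (lb <= i)%N && chain (fun r => st r.+1) (i + st 0%N) m.
Proof.
apply/andP/andP => [[/forallP h0 /forallP h]|[lei /andP[/forallP h0 /forallP h]]].
  have := h0 ord0; rewrite ffun_consE0 => /implyP/(_ isT) /= lei; split=> //.
  apply/andP; split; apply/forallP => r.
    apply/implyP => /eqP r0; have /forallP/(_ (lift ord0 r)) := h ord0.
    by rewrite ffun_consE0 ffun_consES /= /bump r0 => /implyP; apply.
  apply/forallP => s; apply/implyP => /eqP es.
  have /forallP/(_ (lift ord0 s)) := h (lift ord0 r).
  by rewrite !ffun_consES /= /bump es !add1n => /implyP; apply.
split; apply/forallP => r.
  by apply/implyP => /eqP r0; have -> : r = ord0 by [apply: val_inj]; rewrite ffun_consE0.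
apply/forallP => s; apply/implyP; case: (unliftP ord0 r) => [r' ->|->];
  case: (unliftP ord0 s) => [s' ->|->] //=;
  rewrite ?ffun_consES ?ffun_consE0 /= /bump ?add1n.
- by rewrite eqSS => es; have /forallP/(_ s') := h r'; move/implyP; apply.
- by rewrite eqSS => es; have := h0 s'; move/implyP; apply.
Qed.

Lemma chainsum_recl d val st lb :
  chainsum d.+1 val st lb =
  \sum_(i < n | (lb <= i)%N)
    val 0%N i * chainsum d (fun r => val r.+1) (fun r => st r.+1) (i + st 0%N).
Proof.
rewrite /chainsum (reindex (@ffun_cons d)) /=; last exact/onW_bij/ffun_cons_bij.
under [RHS]eq_bigr => i _ do rewrite big_distrr.
rewrite pair_big_dep /=; apply: eq_big => [[i m]|[i m] _]; first exact: chain_cons.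
rewrite big_ord_recl ffun_consE0; congr (_ * _).
by apply: eq_bigr => r _; rewrite ffun_consES.
Qed.

(** Splitting on whether the first value is [lb] gives the recursion [F_consS]. *)
Lemma chainsumS d val st lb (ltlb : (lb < n)%N) :
  chainsum d.+1 val st lb =
  val 0%N (Ordinal ltlb) *
    chainsum d (fun r => val r.+1) (fun r => st r.+1) (lb + st 0%N) +
  chainsum d.+1 val st lb.+1.
Proof.
rewrite !chainsum_recl (bigD1 (Ordinal ltlb)) //=; congr (_ + _).
by apply: eq_bigl => i; rewrite -val_eqE /=; lia.
Qed.

Lemma chainsum_oversize d val st lb : (n <= lb)%N -> chainsum d.+1 val st lb = 0.
Proof.
by move=> lelb; rewrite chainsum_recl big1 // => i lei; have := ltn_ord i; lia.
Qed.

Lemma run_of_cons0 c r : run_of (0 :: c) r = (run_of c r).+1.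
Proof. by []. Qed.

Lemma run_of_consS0 a c : run_of (a.+1 :: c) 0 = 0%N.
Proof. by []. Qed.

Lemma run_of_consSS a c r : run_of (a.+1 :: c) r.+1 = run_of (a :: c) r.
Proof. by []. Qed.

Variables (var : bool -> 'I_n -> A) (zs : seq A).
Hypothesis size_zs : size zs = n.*2.
Hypothesis zsE : forall (e : bool) (i : 'I_n), nth 0 zs (i.*2 + e) = var e i.

(* [e] is the number of runs preceding those of [c]. *)
Definition runsum (e : nat) c lb :=
  chainsum (sumn c) (fun r => var (odd (e + run_of c r)))
    (fun r => (e + run_of c r)./2 != (e + run_of c r.+1)./2) lb.

Lemma runsum_cons0 e c lb : runsum e (0 :: c) lb = runsum e.+1 c lb.
Proof.
by apply: eq_chainsum => r _; rewrite !run_of_cons0 !addnS.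
Qed.

(** The list is dropped up to the variable of index [lb] and of the letter of the current run. The
    first run must be nonempty because skipping an empty run of y moves the list to the next index,
    but not [lb]. *)
Lemma runsumE e c lb : sorted no00 c -> (0 < head 1 c)%N ->
  runsum e c lb = F c (drop (lb.*2 + odd e) zs).
Proof.
have [N] := ubnP (size c); elim: N c e lb => // N IHN [|[|a] c] // e lb ltN sc _.
  by rewrite /runsum chainsum0.
pose st a r := (e + run_of (a.+1 :: c) r)./2 != (e + run_of (a.+1 :: c) r.+1)./2.
(* Takes off the first position, by induction on the number [n - lb'] of values left. *)
have step a' : (forall lb', chainsum (sumn (a' :: c))
    (fun r => var (odd (e + run_of (a' :: c) r))) (fun r => st a' r.+1)
    (lb' + st a' 0%N) = F (a' :: c) (drop (lb'.*2 + odd e) zs)) ->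
    forall lb', runsum e (a'.+1 :: c) lb' = F (a'.+1 :: c) (drop (lb'.*2 + odd e) zs).
  move=> rest lb'; have [k] := ubnP (n - lb'); elim: k lb' => // k IHk lb' ltk.
  have [lelb|ltlb] := leqP n lb'.
    by rewrite /runsum chainsum_oversize // drop_oversize // size_zs; lia.
  rewrite /runsum (chainsumS _ _ _ ltlb) -/(runsum e (a'.+1 :: c) _) IHk; last lia.
  rewrite (@F_drop _ _ _ _ (lb'.*2 + odd e));
    last by rewrite size_zs; case: (odd e) => /=; lia.
  rewrite -(rest lb'); congr (_ * _ + _).
  by rewrite run_of_consS0 addn0 -zsE.
have {ltN}ltN : (size c < N)%N by [].
elim: a sc lb => [|a IHa] sc; apply: step => lb; last first.
  have -> : st a.+1 0%N = false by rewrite /st !run_of_consSS !run_of_consS0 eqxx.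
  have sc' : sorted no00 (a.+1 :: c) by case: (c) sc => //= ? ? ->.
  by rewrite -(IHa sc') [(lb + _)%N]addn0.
have [sc0|] := posnP (sumn c).
  by rewrite /= add0n sc0 chainsum0 F_sumn0.
rewrite -[LHS]/(runsum e (0 :: c) (lb + st 0%N 0%N)) runsum_cons0 F_cons0.
rewrite -drop1 drop_drop.
(* The next nonempty run is at most two runs away; passing a block boundary raises the bound by one
   and the list by one pair. *)
case: c sc @st ltN => [|[|b] [|[|d] c]] // /andP[_ sc] st ltN _.
- rewrite runsum_cons0 IHN //; last exact: ltnW.
  rewrite F_cons0 -drop1 drop_drop; congr (F _ (drop _ _)).
  rewrite /st run_of_consSS !run_of_cons0 !run_of_consS0; lia.
- rewrite IHN //; congr (F _ (drop _ _)).
  rewrite /st run_of_consSS !run_of_cons0 !run_of_consS0; lia.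
- rewrite IHN //; congr (F _ (drop _ _)).
  rewrite /st run_of_consSS !run_of_cons0 !run_of_consS0; lia.
- rewrite IHN //; congr (F _ (drop _ _)).
  rewrite /st run_of_consSS !run_of_cons0 !run_of_consS0; lia.
Qed.

End ChainSums.

(** * Independence *)

Lemma F_rmorph (A B : comNzRingType) (h : {rmorphism A -> B}) b zs :
  h (F b zs) = F b (map h zs).
Proof.
move: b zs; apply: F_ind => [zs|b zs IH|a b|a b z zs IH1 IH2].
- by rewrite !F_nil rmorph1.
- by rewrite !F_cons0 IH behead_map.
- by rewrite !F_nil_vars rmorph0.
- by rewrite /= !F_consS rmorphD rmorphM IH1 IH2 behead_map.
Qed.

Lemma mon_prod (A : comNzRingType) (zs : seq A) u : size u = size zs ->
  mon zs u = \prod_(k < size zs) nth 0 zs k ^+ nth 0%N u k.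
Proof.
elim: zs u => [|z zs IH] [|a u] //=; first by rewrite big_ord0.
by case=> /IH->; rewrite big_ord_recl.
Qed.

Lemma size_insert00 (T : Type) (x : T) q s : (q <= size s)%N ->
  size (insert00 x q s) = (size s).+2.
Proof. by move=> leq; rewrite size_cat size_take_min /= size_drop; lia. Qed.

Lemma insert00_cat (T : Type) (x : T) s1 s2 :
  insert00 x (size s1) (s1 ++ s2) = s1 ++ [:: x, x & s2].
Proof. by rewrite /insert00 take_size_cat // drop_size_cat. Qed.

Lemma insert00_catS (T : Type) (x a : T) s1 s2 :
  insert00 x (size s1).+1 (s1 ++ a :: s2) = s1 ++ [:: a, x, x & s2].
Proof. by rewrite -cat_rcons -(size_rcons s1 a) insert00_cat cat_rcons. Qed.

Lemma insert00_rem q (u : seq nat) : (q.+1 < size u)%N ->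
    nth 0%N u q = 0%N -> nth 0%N u q.+1 = 0%N ->
  insert00 0%N q (take q u ++ drop q.+2 u) = u.
Proof.
move=> ltq u0 u1; have sq : size (take q u) = q by rewrite size_takel; lia.
rewrite -{1}sq insert00_cat -[RHS](cat_take_drop q); congr (_ ++ _).
by rewrite (drop_nth 0%N (ltnW ltq)) (drop_nth 0%N ltq) u0 u1.
Qed.

Lemma mon_insert00 (A : comNzRingType) (zs : seq A) u q : size u = size zs ->
    (q <= size zs)%N ->
  mon (insert00 0 q zs) (insert00 0%N q u) = mon zs u.
Proof.
move=> szu leq.
have szt : size (take q zs) = size (take q u) by rewrite !size_takel ?szu.
rewrite mon_cat //= !expr0 !mul1r -mon_cat //.
by rewrite !cat_take_drop.
Qed.

Lemma mon_insert00_eq0 (A : comNzRingType) (zs : seq A) u q :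
    size u = (size zs).+2 -> (q <= size zs)%N ->
    (0 < nth 0%N u q)%N || (0 < nth 0%N u q.+1)%N ->
  mon (insert00 0 q zs) u = 0.
Proof.
move=> szu leq u0; have sz := size_insert00 (0 : A) leq.
rewrite mon_prod ?sz //.
have [k [ltk uk zk]] : exists k, [/\ (k < (size zs).+2)%N, (0 < nth 0%N u k)%N
    & nth 0 (insert00 0 q zs) k = 0].
  case/orP: u0 => uk; [exists q | exists q.+1]; split=> //; try lia;
    by rewrite nth_cat size_takel // ?ltnn ?ltnNge ?leqnSn ?subnn ?subSnn.
by rewrite (bigD1 (Ordinal ltk)) //= zk expr0n gtn_eqF // mul0r.
Qed.

(** Prefixes reaching past position [q] can be extended by two entries while gaining one unit of
    sum. *)
Lemma trans_insert00 s q : (q < size s)%N -> trans s ->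
  trans (insert00 0%N q (incr_nth s q)) /\ trans (insert00 0%N q.+1 (incr_nth s q)).
Proof.
move=> ltq; rewrite -{1}(cat_take_drop q s) (drop_nth 0%N ltq).
rewrite -(cat_take_drop q (incr_nth s q)).
have -> : take q (incr_nth s q) = take q s.
  by elim: s q ltq => [|c s IHs] [|q] //= /IHs->.
have -> : drop q (incr_nth s q) = (nth 0%N s q).+1 :: drop q.+1 s.
  by elim: s q ltq => [|c s IHs] [|q] //= ltq; rewrite ?drop0 //; apply: IHs.
have sq : size (take q s) = q by rewrite size_takel; lia.
move: (take q s) (nth 0%N s q) (drop q.+1 s) sq => s1 a s2 <- {s q ltq}.
rewrite insert00_cat insert00_catS.
case=> j /andP[j0]; rewrite take_cat; case: ltnP => [ltj|lej]; rewrite ?sumn_cat => hj.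
  by split; exists j; rewrite j0 take_cat ltj.
have ej : (j = size s1 + (j - size s1))%N by lia.
move: (j - size s1)%N ej hj {lej} => k ej hj; subst j; case: k hj j0 => [|k] /= hj j0.
  by split; exists (size s1); rewrite take_cat ltnn subnn /= cats0; lia.
split; exists (size s1 + k.+3)%N; rewrite take_cat;
  (have -> : (size s1 + k.+3 < size s1)%N = false by lia);
  rewrite addKn sumn_cat /=; lia.
Qed.

(** * Substitutions that insert two zero variables *)

Definition mseq N (s : seq nat) : 'X_{1..N} := [multinom nth 0%N s i | i < N].

Lemma mseqK N s : size s = N -> mseq N s = s :> seq nat.
Proof.
move=> ss; apply: (@eq_from_nth _ 0%N); rewrite size_tuple // => i ltiN.
by rewrite -(mnm_nth 0%N (mseq N s) (Ordinal ltiN)) mnmE.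
Qed.

Lemma nth_insert00_0 q (s : seq nat) i : (forall k, nth 0%N s k = 0%N) ->
  nth 0%N (insert00 0%N q s) i = 0%N.
Proof.
move=> s0; rewrite nth_cat; case: ltnP => [lti|_].
  by rewrite nth_take // (leq_trans lti) // size_take; case: ltnP => // /ltnW.
by case: (i - _)%N => [|[|k]] //=; rewrite nth_drop.
Qed.

Lemma nth_mnm0 N k : nth 0%N (0%MM : 'X_{1..N}) k = 0%N.
Proof.
have [ltk|lek] := ltnP k N; last by rewrite nth_default ?size_tuple.
by rewrite -(mnm_nth _ _ (Ordinal ltk)) mnm0E.
Qed.

Lemma mseq_id N (m : 'X_{1..N}) : mseq N m = m.
Proof. by apply/mnmP => i; rewrite mnmE -mnm_nth. Qed.

(** The twisted Leibniz rule, with [a1, a2] and [b1, b2] the images of two factors under two ring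
    morphisms. *)
Lemma mulr_diff (A : comNzRingType) (x a1 a2 b1 b2 s t : A) :
  a1 - a2 = x * s -> b1 - b2 = x * t -> a1 * b1 - a2 * b2 = x * (a1 * t + s * b2).
Proof.
by move=> es et; rewrite mulrDr mulrCA -et mulrA -es mulrBr mulrBl addrA subrK.
Qed.

Local Notation poly N := {mpoly rat[N]}.

Definition mvars N : seq (poly N) := [seq 'X_i | i <- enum 'I_N].

Lemma size_mvars N : size (mvars N) = N.
Proof. by rewrite size_map size_enum_ord. Qed.

Lemma nth_mvars N (i : 'I_N) : nth 0 (mvars N) i = 'X_i.
Proof. by rewrite (nth_map i) ?size_enum_ord // nth_ord_enum. Qed.

Lemma mon_mvars N (m : 'X_{1..N}) : mon (mvars N) m = 'X_[m].
Proof.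
rewrite mon_prod size_mvars ?size_tuple // mpolyXE_id.
by apply: eq_bigr => i _; rewrite nth_mvars -mnm_nth.
Qed.

Definition subst N M (L : seq (poly N)) : {rmorphism poly M -> poly N} :=
  comp_mpoly [tuple nth 0 L i | i < M].

Lemma substX N M L (i : 'I_M) : @subst N M L 'X_i = nth 0 L i.
Proof. by rewrite /subst /= comp_mpolyXU -tnth_nth tnth_mktuple. Qed.

Lemma subst_mon N M L (m : 'X_{1..M}) : size L = M -> @subst N M L 'X_[m] = mon L m.
Proof.
move=> sL; rewrite /subst /= comp_mpolyX mon_prod sL ?size_tuple //.
by apply: eq_bigr => i _; rewrite tnth_mktuple -mnm_nth.
Qed.

Lemma subst_mvars N M L : size L = M -> map (@subst N M L) (mvars M) = L.
Proof.
move=> sL; apply: (@eq_from_nth _ 0); rewrite size_map size_mvars ?sL // => i ltiM.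
by rewrite (nth_map 0) ?size_mvars // (nth_mvars (Ordinal ltiM)) substX.
Qed.

(* Locked, as unification must not unfold [ins q] when comparing it with       *)
(* [ins q.+1].                                                                 *)
HB.lock Definition ins N q : {rmorphism poly N.+2 -> poly N} :=
  @subst N N.+2 (insert00 0 q (mvars N)).

Arguments ins {N} q.

Lemma insZ N q c (p : poly N.+2) : ins q (c *: p) = c *: ins q p.
Proof. by rewrite ins.unlock; apply: comp_mpolyZ. Qed.

Lemma insD N q (p r : poly N.+2) : ins q (p + r) = ins q p + ins q r.
Proof. exact: rmorphD. Qed.

Lemma insM N q (p r : poly N.+2) : ins q (p * r) = ins q p * ins q r.
Proof. exact: rmorphM. Qed.

Lemma ins0 N q : ins q (0 : poly N.+2) = 0.
Proof. exact: rmorph0. Qed.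

Lemma ins1 N q : ins q (1 : poly N.+2) = 1.
Proof. exact: rmorph1. Qed.

Lemma ins_sum N q K (h : 'I_K -> poly N.+2) :
  ins q (\sum_(i < K) h i) = \sum_(i < K) ins q (h i).
Proof. exact: rmorph_sum. Qed.

Lemma insX N q (i : 'I_N.+2) : ins q 'X_i = nth 0 (insert00 0 q (mvars N)) i.
Proof. by rewrite ins.unlock substX. Qed.

Lemma ins_mon N q (m : 'X_{1..N.+2}) : (q <= N)%N ->
  ins q 'X_[m] = mon (insert00 0 q (mvars N)) m.
Proof. by move=> leq; rewrite ins.unlock subst_mon ?size_insert00 ?size_mvars. Qed.

Lemma ins_F N q b : sorted no00 b -> (q <= N)%N ->
  ins q (F b (mvars N.+2)) = F b (mvars N).
Proof.
move=> sb leq; rewrite F_rmorph ins.unlock subst_mvars ?F_insert00 ?size_mvars //.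
by rewrite size_insert00 size_mvars.
Qed.

(** Monomials with a positive exponent at an inserted place vanish; the others stay distinct. *)
Lemma mcoeff_ins N q (p : poly N.+2) m : (q <= N)%N ->
  (ins q p)@_m = p@_(mseq N.+2 (insert00 0%N q m)).
Proof.
move=> leq; have szi : size (insert00 0%N q m) = N.+2 by rewrite size_insert00 size_tuple.
elim/mpolyind: p => [|c u p _ _ IHp]; first by rewrite ins0 !mcoeff0.
rewrite insD insZ !mcoeffD !mcoeffZ IHp; congr (_ * _ + _) => {c p IHp}.
rewrite ins_mon // mcoeffX.
have [->|neq] := eqVneq u (mseq N.+2 (insert00 0%N q m)).
  by rewrite mseqK // mon_insert00 ?size_mvars ?size_tuple // mon_mvars mcoeffX eqxx.
have [u0|] := boolP ((0 < nth 0 u q) || (0 < nth 0 u q.+1))%N.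
  by rewrite mon_insert00_eq0 ?size_mvars ?size_tuple // mcoeff0.
rewrite negb_or -!eqn0Ngt => /andP[/eqP u0 /eqP u1].
have eu : insert00 0%N q (take q u ++ drop q.+2 u) = u.
  by apply: insert00_rem; rewrite ?size_tuple.
have sw : size (take q u ++ drop q.+2 u) = N.
  by rewrite size_cat size_drop size_takel ?size_tuple; lia.
rewrite -eu mon_insert00 ?size_mvars // -(mseqK sw) mon_mvars mcoeffX.
case: eqP => // em; case/eqP: neq.
by rewrite -em mseqK // eu mseq_id.
Qed.

(** The two substitutions agree modulo ['X_q], since they only exchange it with a zero two places
    away. *)
Lemma ins_diff_dvd N (q : 'I_N) (p : poly N.+2) :
  exists t, ins q.+1 p - ins q p = 'X_q * t.
Proof.
pose P p := exists t, ins q.+1 p - ins q p = 'X_q * t.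
have PM x y : P x -> P y -> P (x * y).
  move=> [t tx] [s sy]; exists (ins q.+1 x * s + t * ins q y).
  by rewrite (insM q.+1) (insM q); apply: mulr_diff.
have PX (i : 'I_N.+2) : P 'X_i.
  rewrite /P !insX; have ltq : (q < size (mvars N))%N by rewrite size_mvars.
  rewrite -(cat_take_drop q (mvars N)) (drop_nth 0 ltq) nth_mvars.
  have sq : size (take q (mvars N)) = q by rewrite size_takel // ltnW.
  move: (take q _) (drop _ _) sq => s1 s2 sq; rewrite -sq.
  rewrite insert00_cat insert00_catS !nth_cat; case: ltnP => _.
    by exists 0; rewrite subrr mulr0.
  case: (i - size s1)%N => [|[|[|k]]] /=.
  - by exists 1; rewrite subr0 mulr1.
  - by exists 0; rewrite subrr mulr0.
  - by exists (-1); rewrite sub0r mulrN mulr1.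
  - by exists 0; rewrite subrr mulr0.
have Pmon m : P 'X_[m].
  rewrite mpolyXE_id; apply: big_ind => // [|i _].
    by exists 0; rewrite !ins1 subrr mulr0.
  elim: (m i) => [|k IHk]; first by exists 0; rewrite !ins1 subrr mulr0.
  by rewrite exprS; apply: PM.
elim/mpolyind: p => [|c m p _ _ [t tp]]; first by exists 0; rewrite !ins0 subrr mulr0.
case: (Pmon m) => s sm; exists (c *: s + t).
rewrite !insD mulrDr -tp -scalerAr -sm !insZ scalerBr.
by rewrite opprD addrACA.
Qed.

(** * The ideal in interleaved variables *)

Definition qsym N (p : poly N) : Prop :=
  exists (K : nat) (a : 'I_K -> rat) (c : 'I_K -> seq nat),
    (forall i, sorted no00 (c i)) /\ p = \sum_(i < K) a i *: F (c i) (mvars N).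

Definition qsym_ideal N : poly N -> Prop :=
  ideal_gen (fun p : poly N => qsym p /\ p@_0%MM = 0).

Lemma qsym_ins N q r (p : poly N.+2) : (q <= N)%N -> (r <= N)%N -> qsym p ->
  ins q p = ins r p /\ qsym (ins q p).
Proof.
move=> leq ler [K [a [c [sc ->]]]].
have E s : (s <= N)%N -> ins s (\sum_(i < K) a i *: F (c i) (mvars N.+2)) =
    \sum_(i < K) a i *: F (c i) (mvars N).
  move=> les; rewrite ins_sum; apply: eq_bigr => i _ /=.
  by rewrite insZ /= ins_F.
by rewrite !E //; split=> //; exists K, a, c.
Qed.

Lemma qsym_ideal_coef0 N (p : poly N) : qsym_ideal p -> p@_0%MM = 0.
Proof.
case=> K [f [g [Sg ->]]]; rewrite raddf_sum big1 // => i _ /=.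
by rewrite rmorphM /= (Sg i).2 mulr0.
Qed.

Lemma qsym_ideal_free n (f : poly n.*2) : qsym_ideal f ->
  (forall m : 'X_{1..n.*2}, trans m -> f@_m = 0) -> f = 0.
Proof.
elim: n f => [|n IHn] f Jf f0; apply/mpolyP.
  move=> m; have -> : m = 0%MM by apply/mnmP => -[].
  by rewrite qsym_ideal_coef0 // mcoeff0.
have insf (q : 'I_n.*2) : ins q.+1 f = ins q f.
  case: Jf f0 => K [h [g [Sg ->]]] f0.
  have [t tE] := fin_all_exists (fun i => ins_diff_dvd q (h i)).
  have insg i : ins q.+1 (g i) = ins q (g i).
    by apply: (qsym_ins _ _ (Sg i).1).1; rewrite // ltnW.
  (* Both substitutions agree on each generator [g i], so the quotient by ['X_q] lies again in the
     ideal, with one pair of variables fewer. *)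
  have fE : ins q.+1 (\sum_(i < K) h i * g i) - ins q (\sum_(i < K) h i * g i) =
      (\sum_(i < K) t i * ins q (g i)) * 'X_q.
    rewrite mulrC !ins_sum -sumrB mulr_sumr; apply: eq_bigr => i _.
    by rewrite !insM insg -mulrBl tE mulrA.
  apply/eqP; rewrite -subr_eq0 fE (IHn (\sum_i _)) ?mul0r //.
    exists K, t, (fun i => ins q (g i)); split=> // i; split.
      by apply: (qsym_ins _ (leq0n _) (Sg i).1).2; apply: ltnW.
    rewrite mcoeff_ins ?(ltnW (ltn_ord _)) // -[RHS](Sg i).2; congr (_@__).
    by apply/mnmP => j; rewrite mnmE mnm0E nth_insert00_0 // => k; apply: nth_mnm0.
  move=> m tm.
  rewrite -[LHS](mcoeffMX _ U_(q)%MM m) -fE mcoeffB !mcoeff_ins ?(ltnW (ltn_ord _)) //.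
  have mE : (U_(q) + m)%MM = incr_nth m q :> seq nat.
    apply: (@eq_from_nth _ 0%N); rewrite ?size_incr_nth ?size_tuple ?ltn_ord // => i ltin.
    rewrite nth_incr_nth -(mnm_nth _ _ (Ordinal ltin)) mnmDE mnm1E.
    by rewrite -(mnm_nth _ _ (Ordinal ltin)).
  have [t1 t2] : trans (insert00 0%N q (U_(q) + m)%MM) /\
                 trans (insert00 0%N q.+1 (U_(q) + m)%MM).
    by rewrite mE; apply: trans_insert00; rewrite ?size_tuple.
  have leq : (q <= n.*2)%N := ltnW (ltn_ord q).
  have sins r : (r <= n.*2)%N -> size (insert00 0%N r (U_(q) + m)%MM) = n.*2.+2.
    by move=> ler; rewrite size_insert00 size_tuple.
  rewrite (f0 (mseq _ (insert00 _ q.+1 _))); last by rewrite mseqK ?sins.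
  rewrite (f0 (mseq _ (insert00 _ q _))); last by rewrite mseqK ?sins.
  exact: subrr.
have fmove (q : 'I_n.*2) (m : 'X_{1..n.*2}) :
    f@_(mseq n.*2.+2 (insert00 0%N q m)) = f@_(mseq n.*2.+2 (insert00 0%N q.+1 m)).
  by rewrite -!mcoeff_ins ?insf // ltnW.
(* A positive entry among the first two is transdiagonal by itself. Further right, one of the two
   preceding entries is positive, or [fmove] brings the entry two places to the left. *)
have fpos p (v : 'X_{1..n.*2.+2}) : (p < n.*2.+2)%N -> (0 < nth 0%N v p)%N -> f@_v = 0.
  elim/ltn_ind: p v => -[|[|q]] IHp v ltp vp.
  - apply: f0; exists 1%N; move: vp; case: (v : seq nat) => [|a [|c u]] //=; lia.
  - apply: f0; exists 2%N; move: vp; case: (v : seq nat) => [|a [|c u]] //=;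
      rewrite ?take0 /=; lia.
  have [vq|] := boolP (0 < nth 0 v q)%N; first by apply: IHp vq; lia.
  have [vq|] := boolP (0 < nth 0 v q.+1)%N; first by move=> _; apply: IHp vq; lia.
  rewrite -!eqn0Ngt => /eqP v1 /eqP v0.
  pose w := take q v ++ drop q.+2 v.
  have sw : size w = n.*2 by rewrite size_cat size_drop size_takel ?size_tuple; lia.
  have ew : insert00 0%N q w = v by apply: insert00_rem; rewrite ?size_tuple; lia.
  have ltq : (q < n.*2)%N by lia.
  have := fmove (Ordinal ltq) (mseq n.*2 w); rewrite mseqK //= ew mseq_id => ->.
  apply: (IHp q); [lia | lia | rewrite mseqK].
    rewrite nth_cat size_takel ?sw // ltnSn nth_take // /w.
    rewrite nth_cat size_takel ?size_tuple; last lia.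
    by rewrite ltnn subnn nth_drop addn0.
  by rewrite size_insert00 sw.
move=> m; rewrite mcoeff0; have [/existsP[i mi]|] := boolP [exists i, m i != 0%N].
  by apply: (fpos i); rewrite ?ltn_ord // -mnm_nth lt0n.
rewrite negb_exists => /forallP m0; have -> : m = 0%MM; last exact: qsym_ideal_coef0.
by apply/mnmP => i; rewrite mnm0E; apply/eqP/negPn/m0.
Qed.

(** * Counting good vectors *)

Definition incr_head (v : seq nat) : seq nat :=
  if v is a :: v' then a.+1 :: v' else [::].

(** The head is 0 or one more than an admissible head: this is the ballot recurrence, cut off at
    [2 * h < j]. The lists are reversed, as for [good_rev]. *)
Fixpoint good_enum (j : nat) : nat -> seq (seq nat) :=
  match j with
  | 0 => fun h => if h is 0 then [:: [::]] else [::]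
  | j'.+1 =>
      fix enum_sum (h : nat) : seq (seq nat) :=
        if (2 * h < j'.+1)%N then
          map (cons 0%N) (good_enum j' h) ++
          (if h is h'.+1 then map incr_head (enum_sum h') else [::])
        else [::]
  end.

Lemma good_enumS j h :
  good_enum j.+1 h =
  if (2 * h < j.+1)%N then
    map (cons 0%N) (good_enum j h) ++
    (if h is h'.+1 then map incr_head (good_enum j.+1 h') else [::])
  else [::].
Proof. by case: h. Qed.

Lemma mem_map_cons0 a w (s : seq (seq nat)) :
  (a :: w \in map (cons 0%N) s) = (a == 0%N) && (w \in s).
Proof.
apply/mapP/andP => [[v vs [-> ->]]|[/eqP-> ws]] //.
by exists w.
Qed.

Lemma mem_map_incr_head a w (s : seq (seq nat)) :
  (a :: w \in map incr_head s) = (0 < a)%N && (a.-1 :: w \in s).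
Proof.
apply/mapP/andP => [[[|c v] vs] //= [-> ->]|[a0 ws]] //.
by exists (a.-1 :: w); rewrite //= prednK.
Qed.

Lemma mem_good_enum_cons j h a w :
  (a :: w \in good_enum j.+1 h) =
  [&& (2 * h < j.+1)%N, (a <= h)%N & w \in good_enum j (h - a)].
Proof.
elim: h a => [|h IHh] a; rewrite good_enumS;
  (case: (boolP (_ < j.+1)%N) => lt2; last by rewrite in_nil).
  by rewrite cats0 mem_map_cons0 leqn0 sub0n.
rewrite mem_cat mem_map_cons0 mem_map_incr_head IHh.
have -> : (2 * h < j.+1)%N by lia.
by case: a => [|a] /=; rewrite ?orbF ?subn0 // ltnS subSS.
Qed.

Lemma nil_good_enum j h : ([::] \in good_enum j h) = (j == 0%N) && (h == 0%N).
Proof.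
case: j => [|j]; first by case: h.
elim: h => [|h IHh]; rewrite good_enumS; (case: (_ < j.+1)%N; last by []);
  rewrite mem_cat.
  by rewrite orbF; apply/mapP => -[].
rewrite [X in X || _](_ : _ = false); last by apply/mapP => -[].
by apply/mapP => -[[|a v]] //; rewrite IHh.
Qed.

Lemma mem_good_enum j h v :
  (v \in good_enum j h) = [&& good_rev v, size v == j & sumn v == h].
Proof.
elim: v j h => [|a v IHv] j h; first by rewrite nil_good_enum !(eq_sym 0%N).
case: j => [|j]; first by rewrite andbF; case: h.
rewrite mem_good_enum_cons IHv /= eqSS; case: (good_rev v); rewrite ?andbF //=.
lia.
Qed.

Lemma uniq_good_enum j h : uniq (good_enum j h).
Proof.
elim: j h => [|j IHj] h; first by case: h.
elim: h => [|h IHh]; rewrite good_enumS; (case: (_ < j.+1)%N; last by []).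
  by rewrite cats0 map_inj_uniq // => ? ? [].
rewrite cat_uniq map_inj_uniq ?IHj /=; last by move=> ? ? [].
rewrite map_inj_in_uniq ?IHh ?andbT.
  apply/hasPn => -[|a w]; first by move=> _; apply/mapP => -[].
  by rewrite mem_map_cons0 mem_map_incr_head; case: a.
by move=> [|a v] [|c w]; rewrite ?nil_good_enum //= => _ _ [-> ->].
Qed.

(** The ballot formula without division or subtraction. The boundary [2 * h = j], where the list is
    empty, is included because the recurrence reaches it. *)
Lemma size_good_enum j h : (2 * h <= j)%N -> (0 < j)%N ->
  ((j + h) * size (good_enum j h) + 2 * h * 'C(j + h, h) = j * 'C(j + h, h))%N.
Proof.
case: j => // j + _; elim: j h => [|j IHj].
  by case=> [|h]; rewrite ?mulnS //= bin0.
elim=> [|h IHh] le_hj.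
  rewrite good_enumS; have -> : (2 * 0 < j.+2)%N by [].
  by have := IHj 0%N isT; rewrite cats0 size_map !bin0; nia.
rewrite good_enumS; case: (ltnP (2 * h.+1)%N j.+2) => [lt_hj|ge_hj]; last first.
  by rewrite muln0 add0n; congr (_ * _)%N; lia.
rewrite size_cat !size_map.
have le1 : (2 * h.+1 <= j.+1)%N by lia.
have le2 : (2 * h <= j.+2)%N by lia.
have := IHj h.+1 le1; have := IHh le2.
have -> : (j.+2 + h.+1 = (j.+2 + h).+1)%N by lia.
have -> : (j.+1 + h.+1 = j.+2 + h)%N by lia.
rewrite binS; have := mul_bin_left (j.+2 + h) h; rewrite addnK.
move: (size _) (size _) 'C(_, _) 'C(_, _) => s2 s1 c2 c1 e3 e2 e1.
nia.
Qed.

Lemma sumn_good_rev v : good_rev v -> (2 * sumn v <= size v)%N.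
Proof. by case: v => //= a v; lia. Qed.

(** The removed head is determined by the total [n], so removing it loses nothing. *)
Definition good_list n : seq (seq nat) := map (rev \o behead) (good_enum n.*2.+1 n).

Lemma size_good_list n : ((2 * n + 1) * size (good_list n) = 'C(3 * n, n))%N.
Proof.
have le : (2 * n <= n.*2.+1)%N by lia.
have := size_good_enum le isT; have := mul_bin_down (3 * n).+1 n.
have -> : (n.*2.+1 + n = (3 * n).+1)%N by lia.
have -> : ((3 * n).+1 - n = 2 * n + 1)%N by lia.
rewrite size_map -pred_Sn; move: (size _) 'C(_, _) 'C(_, _) => s c1 c2 e1 e2.
nia.
Qed.

Lemma mem_good_list n v : (v \in good_list n) = good v && (size v == n.*2).
Proof.
apply/mapP/andP => [[w]|[gv /eqP sv]].
  rewrite mem_good_enum; case: w => [|a w] //=.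
  by case/and3P=> /andP[gw _] sw _ ->; rewrite /good revK size_rev.
exists ((n - sumn v)%N :: rev v); last by rewrite /= revK.
have := sumn_good_rev gv; rewrite mem_good_enum /=.
rewrite -[good_rev _]/(good v) gv sumn_rev size_rev sv eqxx; lia.
Qed.

Lemma uniq_good_list n : uniq (good_list n).
Proof.
rewrite map_inj_in_uniq; last first.
  move=> [|a v] [|c w]; rewrite !mem_good_enum ?andbF //=.
  move=> /and3P[_ _ /eqP sv] /and3P[_ _ /eqP sw] /(congr1 rev); rewrite !revK => evw.
  by congr cons => //; move: sv sw; rewrite evw; lia.
exact: uniq_good_enum.
Qed.

(** * Closure properties of generated ideals *)

Lemma ideal_genD (R : comNzRingType) (S : R -> Prop) p q :
  ideal_gen S p -> ideal_gen S q -> ideal_gen S (p + q).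
Proof.
move=> [K1 [f1 [g1 [S1 ->]]]] [K2 [f2 [g2 [S2 ->]]]].
pose glue T (u : 'I_K1 -> T) (v : 'I_K2 -> T) i :=
  match split i with inl j => u j | inr j => v j end.
exists (K1 + K2)%N, (glue _ f1 f2), (glue _ g1 g2); split=> [i|].
  by rewrite /glue; case: split.
rewrite big_split_ord /glue /=; congr (_ + _); apply: eq_bigr => i _.
  by rewrite (unsplitK (inl i)).
by rewrite (unsplitK (inr i)).
Qed.

Lemma ideal_genM (R : comNzRingType) (S : R -> Prop) r p :
  ideal_gen S p -> ideal_gen S (r * p).
Proof.
move=> [K [f [g [Sg ->]]]]; exists K, (fun i => r * f i), g; split=> //.
by rewrite mulr_sumr; apply: eq_bigr => i _; rewrite mulrA.
Qed.

Lemma ideal_gen_mem (R : comNzRingType) (S : R -> Prop) p : S p -> ideal_gen S p.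
Proof.
move=> Sp; exists 1%N, (fun=> 1), (fun=> p); split=> //.
by rewrite big_ord1 mul1r.
Qed.

(** * Basis of the quotient *)

Section Basis.

Variable n : nat.

Definition bivar (e : bool) (i : 'I_n) : bipoly n := if e then yvar i else xvar i.

Definition bivars : seq (bipoly n) :=
  mkseq (fun k => nth 0 [seq bivar (odd k) i | i <- enum 'I_n] k./2) n.*2.

Lemma size_bivars : size bivars = n.*2. Proof. exact: size_mkseq. Qed.

Lemma nth_bivars (e : bool) (i : 'I_n) : nth 0 bivars (i.*2 + e) = bivar e i.
Proof.
rewrite nth_mkseq; last by case: e; have := ltn_ord i; lia.
have -> : odd (i.*2 + e) = e by rewrite oddD odd_double oddb.
have -> : (i.*2 + e)./2 = i by case: e; lia.
by rewrite (nth_map i) ?size_enum_ord // nth_ord_enum.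
Qed.

Lemma fundB_F c : bicomposition c -> fundB n c = F c bivars.
Proof.
case/andP=> _ sc; have -> : fundB n c = runsum bivar 0 c 0.
  rewrite /fundB /runsum /chainsum; apply: eq_big => [m|m _].
    rewrite /admissible /chain [X in _ = X && _](_ : _ = true) /=; last first.
      by apply/forallP => r; rewrite leq0n implybT.
    apply: eq_forallb => r; apply: eq_forallb => s; case: eqP => //= es.
    by rewrite es !add0n /block_of; case: eqP => _ /=; rewrite ?addn0 ?addn1.
  by apply: eq_bigr => r _; rewrite add0n /bivar.
have E := runsumE size_bivars nth_bivars.
(* An empty first run is skipped before [runsumE] applies. *)
case: c sc => [|[|a] c] sc; try by rewrite E // drop0.
rewrite runsum_cons0 E; [by rewrite F_cons0 drop1 | exact: path_sorted sc|].
by case: c sc => [|[|c1] c].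
Qed.

Lemma ok_sumn b : ok b -> b != [::] -> (0 < sumn b)%N.
Proof.
elim: b => [|a [|c b] IHb] //= /andP[okb ac] _; first by lia.
by have := IHb okb isT => /=; lia.
Qed.

(** An odd length is mended by a final zero, invisible to [F]; the entry before it is positive. *)
Lemma ok_bicomposition b : ok b ->
  exists2 c, bicomposition c & forall zs : seq (bipoly n), F c zs = F b zs.
Proof.
move=> okb; have sb := ok_sorted okb.
have [ob|eb] := boolP (odd (size b));
  last by exists b; rewrite ?/bicomposition ?/bivector ?eb.
exists (rcons b 0%N) => [|zs]; last exact: F_rcons0.
rewrite /bicomposition /bivector size_rcons /= ob /=.
case: b okb sb {ob} => [|a b] //= okb sb; rewrite rcons_path sb /=.
suff : (0 < last a b)%N by rewrite /no00 eqxx andbT lt0n.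
elim: b a okb {sb} => [|c b IHb] a /=; first by rewrite orbF.
by case/andP=> /IHb.
Qed.

Lemma mcoeff0_F N c (zs : seq {mpoly rat[N]}) : all (fun z => z@_0%MM == 0) zs ->
  (F c zs)@_0%MM = F c (nseq (size zs) 0).
Proof.
move=> zs0; rewrite -[LHS]/((mcoeff 0%MM : {rmorphism _ -> _}) _) F_rmorph.
congr (F _ _); elim: zs zs0 => //= z zs IHzs /andP[/eqP-> /IHzs->] //.
Qed.

Lemma bivars0 : all (fun z : bipoly n => z@_0%MM == 0) bivars.
Proof.
apply/(all_nthP 0) => k; rewrite size_bivars => ltk.
have ltk2 : (k./2 < n)%N by lia.
have -> : k = ((Ordinal ltk2).*2 + odd k)%N by rewrite /= addnC odd_double_half.
by rewrite nth_bivars /bivar; case: odd; rewrite /xvar /yvar mcoeffX mnm1_eq0.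
Qed.

Lemma mvars0 N : all (fun z : {mpoly rat[N]} => z@_0%MM == 0) (mvars N).
Proof. by apply/allP => _ /mapP[i _ ->]; rewrite mcoeffX mnm1_eq0. Qed.

Lemma idealB_F b : ok b -> b != [::] -> idealB (F b bivars).
Proof.
move=> okb b0; apply: ideal_gen_mem; split; last first.
  by rewrite mcoeff0_F ?bivars0 // F_zeros // ok_sumn.
have [c bc Ec] := ok_bicomposition okb; exists 1%N, (fun=> 1), (fun=> c); split=> //.
by rewrite big_ord1 scale1r fundB_F.
Qed.

Definition position (i : 'I_(n + n)) : nat :=
  match split i with inl j => j.*2 | inr j => j.*2.+1 end.

Definition interleave : {rmorphism bipoly n -> {mpoly rat[n.*2]}} :=
  comp_mpoly [tuple nth 0 (mvars n.*2) (position i) | i < n + n].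

Lemma interleaveZ c p : interleave (c *: p) = c *: interleave p.
Proof. exact: comp_mpolyZ. Qed.

Lemma interleave_bivar e i :
  interleave (bivar e i) = nth 0 (mvars n.*2) (i.*2 + e).
Proof.
rewrite /bivar /xvar /yvar; case: e; rewrite /interleave /= comp_mpolyXU;
  rewrite -tnth_nth tnth_mktuple /position.
  by rewrite (unsplitK (inr i)) addn1.
by rewrite (unsplitK (inl i)) addn0.
Qed.

Lemma map_interleave : map interleave bivars = mvars n.*2.
Proof.
apply: (@eq_from_nth _ 0); rewrite size_map size_bivars ?size_mvars // => k ltk.
have ltk2 : (k./2 < n)%N by lia.
rewrite (nth_map 0) ?size_bivars //.
have -> : k = ((Ordinal ltk2).*2 + odd k)%N by rewrite /= addnC odd_double_half.
by rewrite nth_bivars interleave_bivar.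
Qed.

Lemma interleave_F c : interleave (F c bivars) = F c (mvars n.*2).
Proof. by rewrite F_rmorph map_interleave. Qed.

Lemma interleave_mon u : interleave (mon bivars u) = mon (mvars n.*2) u.
Proof.
rewrite -map_interleave; elim: bivars u => [|z zs IH] [|a u] /=; rewrite ?rmorph1 //.
by rewrite rmorphM rmorphXn /= IH.
Qed.

Lemma interleave_idealB p : idealB p -> qsym_ideal (interleave p).
Proof.
case=> K [f [g [Sg ->]]].
exists K, (fun i => interleave (f i)), (fun i => interleave (g i)); split; last first.
  by rewrite rmorph_sum; apply: eq_bigr => i _; apply: rmorphM.
move=> i; have [[L [a [c [bc eg]]]] g0] := Sg i.
have Eg : interleave (g i) = \sum_(j < L) a j *: F (c j) (mvars n.*2).
  rewrite eg rmorph_sum; apply: eq_bigr => j _.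
  by rewrite [LHS]interleaveZ fundB_F // interleave_F.
split; first by exists L, a, c; split=> // j; have /andP[] := bc j.
(* Both constant terms are the same combination of values of [F] at zero variables. *)
rewrite -[RHS]g0 Eg eg !raddf_sum; apply: eq_bigr => j _ /=.
by rewrite !mcoeffZ fundB_F // !mcoeff0_F ?mvars0 ?bivars0 // size_mvars size_bivars.
Qed.

Let is_mon (p : bipoly n) := exists2 u, size u = n.*2 & p = mon bivars u.

Lemma bipolyX_mon m : is_mon 'X_[m].
Proof.
suff : forall q, is_mon q -> is_mon ('X_[m] * q).
  by move=> /(_ 1); rewrite mulr1; apply; exists (nseq n.*2 0%N);
    rewrite ?size_nseq ?mon_nseq0.
rewrite mpolyXE_id.
apply: (big_ind (fun p => forall q, is_mon q -> is_mon (p * q))) => [q|p r IHp IHr q|i _].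
- by rewrite mul1r.
- by rewrite -mulrA => /IHr/IHp.
suff Xi q : is_mon q -> is_mon ('X_i * q).
  elim: (m i) => [q|k IHk q /IHk/Xi]; first by rewrite expr0 mul1r.
  by rewrite mulrA -exprS.
case=> u su ->.
have [e [j ->]] : exists e j, 'X_i = bivar e j.
  by rewrite -[i]splitK; case: (split i) => j; [exists false, j | exists true, j].
have ltj : (j.*2 + e < n.*2)%N by case: e; have := ltn_ord j; lia.
exists (incr_nth u (j.*2 + e)); first by rewrite size_incr_nth su ltj.
by rewrite mon_incr ?size_bivars ?su // nth_bivars.
Qed.

Definition good_mon (i : 'I_(size (good_list n))) : bipoly n :=
  mon bivars (nth [::] (good_list n) i).

Lemma good_mon_span (p : bipoly n) :
  exists a : 'I_(size (good_list n)) -> rat, idealB (p - \sum_i a i *: good_mon i).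
Proof.
pose V p := exists a : 'I_(size (good_list n)) -> rat,
  idealB (p - \sum_i a i *: good_mon i).
have VI q : idealB q -> V q.
  move=> Iq; exists (fun=> 0); rewrite big1 ?subr0 // => i _; exact: scale0r.
have VD q r : V q -> V r -> V (q + r).
  move=> [a aq] [b br]; exists (fun i => a i + b i).
  under eq_bigr do rewrite scalerDl.
  by rewrite big_split /= opprD addrACA; apply: ideal_genD.
have VZ c q : V q -> V (c *: q).
  move=> [a aq]; exists (fun i => c * a i).
  under eq_bigr do rewrite -scalerA.
  by rewrite -scaler_sumr -scalerBr -mul_mpolyC; apply: ideal_genM.
have VN q : V q -> V (- q) by rewrite -scaleN1r; apply: VZ.
have V0 : V 0.
  by rewrite -(scale0r 0); apply/VZ/VI; exists 0%N, (fun=> 0), (fun=> 0); split;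
    [case | rewrite big_ord0].
have Vgood u : size u = size bivars -> good u -> V (mon bivars u).
  rewrite size_bivars => su gu.
  have ug : u \in good_list n by rewrite mem_good_list gu su eqxx.
  have ltu : (index u (good_list n) < size (good_list n))%N by rewrite index_mem.
  exists (fun i => (i == Ordinal ltu)%:R).
  rewrite (bigD1 (Ordinal ltu)) //= eqxx scale1r big1 => [|i /negPf->];
    last exact: scale0r.
  rewrite /good_mon /= nth_index // addr0 subrr.
  by exists 0%N, (fun=> 0), (fun=> 0); split; [case | rewrite big_ord0].
elim/mpolyind: p => [//|c m p _ _ Vp]; apply: (VD _ _ _ Vp); apply: (VZ).
have [u su ->] := bipolyX_mon m.
apply: (@mon_mem _ (@idealB n) bivars _ _ V VD VN VI Vgood); rewrite ?size_bivars //.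
- exact: ideal_genM.
- exact: idealB_F.
Qed.

Lemma good_mon_free (a : 'I_(size (good_list n)) -> rat) :
  idealB (\sum_i a i *: good_mon i) -> forall i, a i = 0.
Proof.
move=> /interleave_idealB.
pose mn (i : 'I_(size (good_list n))) := mseq n.*2 (nth [::] (good_list n) i).
have nth_good (i : 'I_(size (good_list n))) :
    nth [::] (good_list n) i \in good_list n by rewrite mem_nth.
have mnE i : mn i = nth [::] (good_list n) i :> seq nat.
  by apply: mseqK; have := nth_good i; rewrite mem_good_list => /andP[_ /eqP].
have -> : interleave (\sum_i a i *: good_mon i) = \sum_i a i *: 'X_[mn i].
  rewrite rmorph_sum; apply: eq_bigr => i _.
  by rewrite [LHS]interleaveZ interleave_mon -mon_mvars mnE.
move=> J; have coefE m : (\sum_i a i *: 'X_[mn i])@_m = \sum_i a i * (mn i == m)%:R.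
  by rewrite raddf_sum; apply: eq_bigr => i _; rewrite /= mcoeffZ mcoeffX.
have z0 : \sum_i a i *: 'X_[mn i] = 0.
  apply: qsym_ideal_free J _ => m /goodPn bm; rewrite coefE big1 // => i _.
  case: eqP => [em|]; rewrite ?mulr0 //; move: bm; rewrite -em mnE.
  by have := nth_good i; rewrite mem_good_list => /andP[->].
move=> i; have := coefE (mn i); rewrite z0 mcoeff0 (bigD1 i) //= eqxx mulr1 big1.
  by rewrite addr0.
move=> j neqji; case: eqP => [e|]; rewrite ?mulr0 //; case/eqP: neqji.
apply/val_inj/eqP; rewrite -(nth_uniq [::] (ltn_ord j) (ltn_ord i) (uniq_good_list n)).
by rewrite -!mnE e.
Qed.

End Basis.

Theorem theorem1 (n : nat) (hn : (1 <= n)%N) :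
  exists d : nat,
    quot_dim (@idealB n) d /\
    d%:R = 1 / (2 * n + 1)%N%:R * 'C(3 * n, n)%:R :> rat.
Proof.
exists (size (good_list n)); split.
  exists (@good_mon n); split; [exact: good_mon_span | exact: good_mon_free].
rewrite -size_good_list natrM div1r mulKf // Num.Theory.pnatr_eq0; lia.
Qed.
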